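(* Let $C^\bullet(x,w)=\sum_{n,k}c^\bullet_{n,k}x^nw^k/n!$, where $c^\bullet_{n,k}$ is the number of vertex-rooted labelled connected planar graphs with $n$ vertices whose root has degree $k$, and let $C^\bullet(x)=C^\bullet(x,1)$. Let $h^\bullet_{n,k}$ be the number of vertex-rooted labelled planar 2-graphs with $n$ vertices whose root has degree $k$, and $H^\bullet(x,w)=\sum_{n,k}h^\bullet_{n,k}x^nw^k/n!$. Then $$H^\bullet(x,w)=e^{x(1-w)}C^\bullet(xe^{-x},w)-xw\,C^\bullet(xe^{-x})-x+x^2w.$$
   Context: A 2-graph is a connected simple graph with minimum degree at least two. A vertex-rooted graph is a labelled graph with one distinguished vertex (the root). The identity is an identity of formal power series. *)

(* Defs.v *)
From HB Require Import structures.
From mathcomp Require Import all_boot all_order all_algebra.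
From mathcomp Require Import all_classical all_reals all_analysis.

Set Implicit Arguments.
Unset Strict Implicit.
Unset Printing Implicit Defensive.

Import Order.TTheory GRing.Theory Num.Theory.
Import numFieldNormedType.Exports.

Local Open Scope ring_scope.

(** * Formal power series in one variable x over a commutative ring *)

Record fps (A : Type) := Fps { fps_coef :> nat -> A }.

HB.instance Definition _ (A : Type) := [isNew for @fps_coef A].
HB.instance Definition _ (A : choiceType) := [Choice of fps A by <:].

Section FpsRing.
Variable A : comNzRingType.
Implicit Types f g h : fps A.

Lemma fpsP f g : (forall n, f n = g n) -> f = g.
Proof. by case: f g => f [g] /= /funext ->. Qed.

Definition fps_zero : fps A := Fps (fun=> 0).
Definition fps_opp f : fps A := Fps (fun n => - f n).
Definition fps_add f g : fps A := Fps (fun n => f n + g n).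
Definition fps_one : fps A := Fps (fun n => (n == 0%N)%:R).
Definition fps_mul f g : fps A := Fps (fun n => \sum_(i < n.+1) f i * g (n - i)%N).

Lemma fps_addA : associative fps_add.
Proof. by move=> f g h; apply: fpsP => n; exact: addrA. Qed.

Lemma fps_addC : commutative fps_add.
Proof. by move=> f g; apply: fpsP => n; exact: addrC. Qed.

Lemma fps_add0 : left_id fps_zero fps_add.
Proof. by move=> f; apply: fpsP => n; exact: add0r. Qed.

Lemma fps_addN : left_inverse fps_zero fps_opp fps_add.
Proof. by move=> f; apply: fpsP => n; exact: addNr. Qed.

HB.instance Definition _ :=
  GRing.isZmodule.Build (fps A) fps_addA fps_addC fps_add0 fps_addN.

Definition fps_trunc n f : {poly A} := \poly_(i < n.+1) f i.

Lemma coef_fps_trunc n f i : (i <= n)%N -> (fps_trunc n f)`_i = f i.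
Proof. by move=> le_in; rewrite coef_poly ltnS le_in. Qed.

Lemma fps_mul_trunc n f g i :
  (i <= n)%N -> fps_mul f g i = (fps_trunc n f * fps_trunc n g)`_i.
Proof.
move=> le_in; rewrite coefM; apply: eq_bigr => j _.
rewrite !coef_fps_trunc //; first exact: leq_trans (leq_subr _ _) le_in.
by apply: leq_trans le_in; rewrite -ltnS.
Qed.

Lemma fps_mulA : associative fps_mul.
Proof.
move=> f g h; apply: fpsP => n.
transitivity (fps_trunc n f * (fps_trunc n g * fps_trunc n h))`_n.
  rewrite coefM; apply: eq_bigr => j _.
  by rewrite coef_fps_trunc ?(fps_mul_trunc _ _ (leq_subr j n)) // -ltnS.
rewrite mulrA coefM; apply: eq_bigr => j _.
have le_jn : (j <= n)%N by rewrite -ltnS.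
by rewrite -(fps_mul_trunc f g le_jn) coef_fps_trunc // leq_subr.
Qed.

Lemma fps_mulC : commutative fps_mul.
Proof.
by move=> f g; apply: fpsP => n; rewrite !(fps_mul_trunc _ _ (leqnn n)) mulrC.
Qed.

Lemma fps_mul1 : left_id fps_one fps_mul.
Proof.
move=> f; apply: fpsP => n; rewrite /= big_ord_recl /= mul1r subn0 big1 ?addr0 //.
by move=> i _; rewrite mul0r.
Qed.

Lemma fps_mulDl : left_distributive fps_mul fps_add.
Proof.
move=> f g h; apply: fpsP => n /=; rewrite -big_split.
by apply: eq_bigr => i _; rewrite /= mulrDl.
Qed.

Lemma fps_one_neq0 : fps_one != fps_zero.
Proof.
by apply/eqP => /(congr1 (fun f : fps A => f 0%N)) /eqP; rewrite /= oner_eq0.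
Qed.

HB.instance Definition _ := GRing.Zmodule_isComNzRing.Build (fps A)
  fps_mulA fps_mulC fps_mul1 fps_mulDl fps_one_neq0.

Definition fpsC (a : A) : fps A := Fps (fun n => if n is 0 then a else 0).

Definition fpsX : fps A := Fps (fun n => (n == 1%N)%:R).

(* f(g(x)), for g without constant term: (g ^+ k) n = 0 as soon as k > n, so
   the sum over all k is finite. *)
Definition fps_comp f g : fps A :=
  Fps (fun n => \sum_(k < n.+1) f k * (g ^+ k) n).

End FpsRing.

Arguments fpsX {A}.

(* The series in x and w below have coefficients in Q[w]: the degree of the
   root is bounded in terms of n, so every coefficient of x^n is a polynomial
   in w. *)
Notation fps_xw := (fps {poly rat}).

Definition fpsW : fps_xw := fpsC 'X.

(* e^g, for g without constant term *)
Definition fps_exp (g : fps_xw) : fps_xw :=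
  fps_comp (Fps (fun k => (k`!%:R^-1)%:P)) g.

(* f(x, 1), seen as a series in x and w *)
Definition fps_w1 (f : fps_xw) : fps_xw := Fps (fun n => (f n).[1]%:P).

(** * Graphs: a graph on the finite vertex set V is given by its edge set *)

Section Graphs.
Variables (V : finType) (E : {set {set V}}).

Definition simple_graph : bool := [forall e in E, #|e| == 2%N].

Definition adj : rel V := [rel u v | [set u; v] \in E].

Definition degree (v : V) : nat := #|[set u | adj v u]|.

Definition connected_graph : bool :=
  (0 < #|V|)%N && [forall u, forall v, connect adj u v].

Definition two_graph : bool :=
  [&& simple_graph, connected_graph & [forall v, 2 <= degree v]%N].

(* A drawing in the plane: p places the vertices, and a e is a simple arc,
   parametrized by [0, 1], joining the two ends of the edge e. *)
Definition planar_drawing (R : realType) (p : V -> R * R)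
    (a : {set V} -> R -> R * R) : Prop :=
  [/\ injective p,
      forall e, e \in E ->
        [/\ ({within `[0, 1], continuous (a e)})%classic,
            {in `[0, 1] &, injective (a e)}
          & [set a e 0; a e 1]%classic = (p @` [set` e])%classic],
      forall e (t : R) v, e \in E -> t \in `]0, 1[ -> a e t <> p v
    & forall e f (s t : R), e \in E -> f \in E -> e != f ->
        s \in `]0, 1[ -> t \in `]0, 1[ -> a e s <> a f t].

Definition planar (R : realType) : Prop :=
  exists (p : V -> R * R) (a : {set V} -> R -> R * R), planar_drawing p a.

End Graphs.

(** * Vertex-rooted labelled graphs; the labels are 0, ..., n-1 *)

(* The number of pairs (graph in the class P, root) with n vertices whose root
   has degree k. *)
Definition rooted_count (P : forall n, {set {set 'I_n}} -> bool) (n k : nat) : nat :=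
  #|[set Gr : {set {set 'I_n}} * 'I_n | P n Gr.1 & degree Gr.1 Gr.2 == k]|.

(* In a simple graph with n vertices, all degrees are less than n. *)
Definition rooted_gf (P : forall n, {set {set 'I_n}} -> bool) : fps_xw :=
  Fps (fun n => \poly_(k < n) ((rooted_count P n k)%:R / n`!%:R)).

Definition connected_planar (R : realType) n (E : {set {set 'I_n}}) : bool :=
  [&& simple_graph E, connected_graph E & `[< planar E R >]].

Definition planar_two_graph (R : realType) n (E : {set {set 'I_n}}) : bool :=
  two_graph E && `[< planar E R >].

Definition Cgf (R : realType) : fps_xw := rooted_gf (@connected_planar R).

Definition Hgf (R : realType) : fps_xw := rooted_gf (@planar_two_graph R).

(* Main.v *)
(* Expanding e^(x(1-w)) C(x e^(-x), w) over vertices amounts to summing over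
   connected planar graphs with a set S of marked leaves not containing the
   root, with sign (-1)^|S|; by inclusion-exclusion only the graphs without
   leaves other than the root survive.  Such a graph is a single vertex, or a
   2-graph, or its root is its only leaf; in the last case, deleting the root
   leaves a graph on at least two vertices, rooted at the neighbour of the old
   root and without leaves other than its root.  This gives the formula.

   Planarity must be shown invariant under adding a leaf at a vertex u. The arcs
   of a drawing are arbitrary curves, so they are first replaced, inside a small
   ball around u, by radii: the part of an arc at u that precedes its last
   exit from the ball becomes a straight segment. The new leaf is then
   put at the end of a radius that no arc uses. *)
Require Import Defs.
From mathcomp Require Import all_boot all_order all_algebra.
From mathcomp Require Import all_classical all_reals all_analysis.
From mathcomp Require Import ring lra.
Set Implicit Arguments.
Unset Strict Implicit.
Unset Printing Implicit Defensive.
Import Order.TTheory GRing.Theory Num.Theory.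
Import numFieldNormedType.Exports.
Local Open Scope ring_scope.

(** * Adding a leaf to a planar drawing *)

(** The times at which [f] equals [r] form a closed set, nonempty by the intermediate value theorem,
    so its supremum [s] belongs to it. A later value at most [r] would force, again by the
    intermediate value theorem, a hitting time beyond [s]. Applied to the distance from a vertex,
    this gives the last exit of an arc from a ball. *)
Lemma last_hit (R : realType) (f : R -> R) (r : R) :
  {within `[0, 1], continuous f}%classic -> f 0 < r -> r < f 1 ->
  exists s : R, [/\ s \in `]0, 1[, f s = r & forall t : R, t \in `]s, 1] -> r < f t].
Proof.
move=> fc f0 f1.
pose A := (f @^-1` [set r] `&` `[0, 1])%classic.
have Acl : closed A.
  have /continuous_closedP/(_ _ (@closed_eq _ r)) := fc.
  move=> /closed_subspaceP[V cV VE].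
  by rewrite /A -VE; apply: closedI => //; exact: itv_closed.
have A0 : (A !=set0)%classic.
  have [|c c01 fc'] := @IVT R f 0 1 r ler01 fc.
    by rewrite ge_min le_max (ltW f0) (ltW f1) orbT.
  by exists c; split.
have hA : has_sup A.
  split=> //; exists 1 => x [_ /=]; rewrite in_itv /= => /andP[] //.
have [fs] : A (sup A).
  apply: itv_closed_supremums => //; split; first exact: sup_upper_bound.
  by move=> x Ax; exact: ge_sup.
rewrite /= in_itv /= => /andP[s0 s1].
set s := sup A in fs s0 s1.
have s0' : 0 < s.
  rewrite lt_neqAle s0 andbT; apply/eqP => E; move: fs; rewrite -E => E'.
  by rewrite E' ltxx in f0.
have s1' : s < 1.
  rewrite lt_neqAle s1 andbT; apply/eqP => E; move: fs; rewrite E => E'.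
  by rewrite E' ltxx in f1.
exists s; split=> //; first by rewrite in_itv /= s0'.
move=> t; rewrite in_itv /= => /andP[st t1]; rewrite ltNge; apply/negP => ft.
have [||c] := @IVT R f t 1 r t1.
- apply: continuous_subspaceW fc => x /=; rewrite !in_itv /= => /andP[tx ->].
  by rewrite andbT; lra.
- by rewrite ge_min le_max ft (ltW f1) orbT.
rewrite in_itv /= => /andP[tc c1] fcr.
have : c <= s.
  have /ubP := sup_upper_bound hA; apply; split=> //=; rewrite in_itv /= c1 andbT; lra.
lra.
Qed.

Lemma avoid_seq (R : realType) (r : R) (l : seq R) : 0 < r ->
  exists2 y, 0 < y <= r & y \notin l.
Proof.
move=> r0; elim: l r r0 => [|x l IH] r r0; first by exists r; rewrite ?r0 ?lexx.
have [x0|x0] := lerP x 0.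
  have [y /andP[y0 yr] yl] := IH _ r0; exists y; rewrite ?y0 ?yr // inE negb_or yl andbT.
  by rewrite gt_eqF //; lra.
have m0 : 0 < Num.min r (x / 2) by rewrite lt_min r0 /=; lra.
have [y] := IH _ m0; rewrite le_min => /and3P[y0 yr yx] yl.
exists y; rewrite ?y0 ?yr // inE negb_or yl andbT lt_eqF //; lra.
Qed.

(** Finitely many positive radii have a positive minimum, and [Q] survives shrinking the radius. *)
Lemma common_bound (R : realType) (I : finType) (Q : I -> R -> Prop) :
  (forall i, exists d, 0 < d /\ Q i d) ->
  (forall i d d', 0 < d' -> d' <= d -> Q i d -> Q i d') ->
  exists2 d, 0 < d & forall i, Q i d.
Proof.
move=> /choice[d dQ] Qdown.
have m0 : 0 < \big[Num.min/1]_i d i.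
  by apply/bigmin_gtP; split=> // i _; have [] := dQ i.
exists (\big[Num.min/1]_i d i) => // i.
by apply: Qdown (dQ i).2 => //; exact: bigmin_le.
Qed.

Lemma dist_arc (R : realType) (a : R -> R * R) (z : R * R) :
  {within `[0, 1], continuous a}%classic ->
  {within `[0, 1], continuous (fun t => `|a t - z|)}%classic.
Proof.
move=> ac; pose g (y : R * R) : R := `|y - z|.
apply: (@within_continuous_comp (R * R)%type R R `[0, 1]%classic a g _ ac).
move=> x _; apply: (@continuous_comp _ _ _ (fun y : R * R => y - z) Num.norm).
  by apply: (@continuousB _ (R * R)%type (R * R)%type id (cst z)) => //; exact: cst_continuous.
exact: norm_continuous.
Qed.

(** Drawings do not orient their arcs; reversal allows every arc at a vertex to be taken as starting
    there. *)
Lemma reverse_arc (R : realType) (a : R -> R * R) :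
  {within `[0, 1], continuous a}%classic -> {in `[0, 1] &, injective a} ->
  {within `[0, 1], continuous (fun t => a (1 - t))}%classic /\
  {in `[0, 1] &, injective (fun t => a (1 - t))}.
Proof.
move=> ac ai; split.
  have hc (x : R) : {for x, continuous (fun t : R => 1 - t)}.
    by apply: (@continuousB _ R R (cst 1) id) => //; exact: cst_continuous.
  move/subspace_continuousP : ac => ac; apply/subspace_continuousP => x.
  rewrite /= in_itv /= => x01; have y01 : 1 - x \in `[0, 1].
    by rewrite in_itv /=; lra.
  apply: (cvg_comp (fun t => 1 - t) a _ (ac _ y01)) => P.
  move=> /(hc x); rewrite /within /=.
  have filt_x : Filter (nbhs x) by exact: nbhs_filter.
  move=> HP; change (nbhs x (fun t => t \in `[0, 1] -> P (1 - t))).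
  apply: (@filterS _ _ filt_x _ _ _ HP) => t {}HP; rewrite in_itv /= => t01; apply: HP.
  by rewrite in_itv /=; lra.
move=> s t; rewrite !in_itv /= => hs ht /ai; rewrite !in_itv /= => E.
have : 1 - s = 1 - t by apply: E; lra.
lra.
Qed.

Lemma radius_continuous (R : realType) (z q : R * R) :
  continuous (fun t : R => z + t *: q).
Proof.
move=> x; apply: (@cvgD _ (R * R)%type R (nbhs x) _ (cst z) (fun t : R => t *: q)).
  exact: cvg_cst.
exact: scalel_continuous.
Qed.

(** Let [s] be the last time at which [b] is at distance [r] from [z]. The new arc runs along the
    radius from [z] to [b s], then follows [b]. It is injective because the radius stays within
    distance [r] while the rest of [b] stays strictly beyond it. The exit point [z + q] is recorded
    as an interior point of [b], so that disjoint arcs get different radii. *)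
Lemma straighten_arc (R : realType) (b : R -> R * R) (z : R * R) (r : R) :
  {within `[0, 1], continuous b}%classic -> {in `[0, 1] &, injective b} ->
  b 0 = z -> 0 < r -> r < `|b 1 - z| ->
  exists (c : R -> R * R) (q : R * R), [/\ {within `[0, 1], continuous c}%classic,
    {in `[0, 1] &, injective c}, c 0 = z /\ c 1 = b 1,
    `|q| = r /\ (exists2 s : R, s \in `]0, 1[ & z + q = b s) &
    forall t : R, t \in `]0, 1[ ->
      (exists2 l : R, 0 < l <= 1 & c t = z + l *: q) \/
      (r < `|c t - z| /\ exists2 s : R, s \in `]0, 1[ & c t = b s)].
Proof.
move=> bc bi b0 r0 rb1.
have [|s [s01 bs bout]] := last_hit (dist_arc (z := z) bc) _ rb1.
  by rewrite b0 subrr normr0.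
have /andP[s0 s1] : 0 < s < 1 by rewrite in_itv in s01.
pose q : R * R := b s - z.
pose aff (t : R) : R * R := z + t *: (s^-1 *: q).
have affE t : aff t = z + (t / s) *: q by rewrite /aff scalerA.
pose c (t : R) : R * R := if t <= s then aff t else b t.
have nq : `|q| = r by [].
have sn0 : s != 0 by rewrite gt_eqF.
have affs : aff s = b s by rewrite affE divff // scale1r /q addrC subrK.
have naff (t : R) : 0 <= t -> `|aff t - z| = t / s * r.
  by move=> t0; rewrite affE addrC addKr normrZ nq ger0_norm // divr_ge0 // ltW.
have naff_le (t : R) : 0 <= t -> t <= s -> `|aff t - z| <= r.
  by move=> t0 ts; rewrite naff // ler_piMl ?(ltW r0) // ler_pdivrMr // mul1r.
have affI t u : aff t = aff u -> t = u.
  rewrite !affE => /addrI/eqP; rewrite -subr_eq0 -scalerBl scaler_eq0 => /orP[|/eqP q0].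
    rewrite -mulrBl mulf_eq0 invr_eq0 (negPf sn0) orbF subr_eq0 => /eqP //.
  by move: r0; rewrite -nq q0 normr0 ltxx.
have bout' (t : R) : s < t -> t <= 1 -> r < `|b t - z|.
  by move=> st t1; apply: bout; rewrite in_itv /= st.
exists c, q; split.
- have <- : (`[0%R, s] `|` `[s, 1%R] = `[0%R, 1%R])%classic.
    apply/seteqP; split=> x /=; rewrite !in_itv /=; first by move=> [] ?; lra.
    by have [xs|xs] := lerP x s; [left|right]; lra.
  apply: withinU_continuous; [exact: itv_closed|exact: itv_closed| |].
    apply: (@subspace_eq_continuous _ _ _ aff).
      by move=> x; rewrite inE /= in_itv /= => /andP[_ xs]; rewrite /from_subspace /c ifT.
    exact: (@continuous_subspaceT R (R * R)%type _ aff (@radius_continuous _ _ _)).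
  apply: (@subspace_eq_continuous _ _ _ b).
    move=> x; rewrite inE /= in_itv /= => /andP[sx _]; rewrite /from_subspace /c.
    by have [xs|//] := lerP x s; rewrite (_ : x = s) ?affs //; lra.
  by apply: continuous_subspaceW bc => x /=; rewrite !in_itv /=; lra.
- move=> t u; rewrite !in_itv /= /c => /andP[t0 t1] /andP[u0 u1].
  have [ts|ts] := lerP t s; have [us|us] := lerP u s.
  + exact: affI.
  + by move=> E; have := bout' _ us u1; rewrite -E ltNge naff_le.
  + by move=> E; have := bout' _ ts t1; rewrite E ltNge naff_le.
  + by apply: bi; rewrite in_itv /= ?t0 ?u0.
- rewrite /c ltW // leNgt s1 /=; split=> //.
  by rewrite /aff scale0r addr0.
- by split=> //; exists s => //; rewrite /q addrC subrK.
- move=> t; rewrite in_itv /= => /andP[t0 t1]; rewrite /c; have [ts|ts] := lerP t s.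
    by left; exists (t / s); rewrite ?affE // divr_gt0 //= ler_pdivrMr // mul1r.
  by right; rewrite bout' ?(ltW t1) //; split=> //; exists t; rewrite // in_itv /= t0.
Qed.

(** The new leaf is [None], and the old vertices are embedded by [Some]. *)
Definition add_leaf (V : finType) (E : {set {set V}}) (u : V) :
    {set {set option V}} :=
  [set None; Some u] |: [set Some @: e | e : {set V} in E].

(** A drawing is pulled back along [f]. With [f := Some] this deletes a leaf; with a bijection it
    relabels. *)
Lemma planar_inj (R : realType) (V V' : finType) (f : V -> V')
    (E : {set {set V}}) (E' : {set {set V'}}) :
  injective f -> (forall e, e \in E -> f @: e \in E') ->
  planar E' R -> planar E R.
Proof.
move=> finj fE [p [a [pinj aE apv aef]]].
exists (p \o f), (fun e : {set V} => a (f @: e)); split.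
- exact: inj_comp.
- move=> e eE; have [ac ai im] := aE _ (fE _ eE); split=> //; rewrite im.
  apply/seteqP; split=> y /= [x].
    by move=> /imsetP[w we ->] <-; exists w.
  by move=> xe <-; exists (f x) => //; apply: imset_f.
- by move=> e t v eE; apply: apv; exact: fE.
- move=> e g s t eE gE eg; apply: aef; rewrite ?fE //.
  by apply: contraNneq eg => /(imset_inj finj) ->.
Qed.

Lemma planar_add_leaf (R : realType) (V : finType) (E : {set {set V}}) (u : V) :
  planar E R -> planar (add_leaf E u) R.
Proof.
move=> [p [a [pinj aE apv aef]]].
pose z := p u.
have endp (e : {set V}) : e \in E -> u \notin e ->
    a e 0 <> z /\ a e 1 <> z.
  move=> eE ue; have [_ _ im] := aE _ eE.
  have zim : ~ (p @` [set` e])%classic z.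
    by move=> [x /= xe /pinj xu]; rewrite -xu xe in ue.
  by split=> ez; apply: zim; rewrite -im -ez; [left|right].
(* The radius [r] isolates [u] from the other vertices and from the arcs of the edges that avoid
   [u]. *)
have [r r0 [rv re]] : exists2 r : R, 0 < r &
    (forall v, v != u -> r < `|p v - z|) /\
    (forall e, e \in E -> u \notin e -> forall t : R, t \in `[0, 1] -> r < `|a e t - z|).
  have [r1 r10 H1] : exists2 r : R, 0 < r & forall v, v != u -> r < `|p v - z|.
    apply: (@common_bound R V (fun v r => v != u -> r < `|p v - z|)).
      move=> v; have [->|vu] := eqVneq v u; first by exists 1.
      have d0 : 0 < `|p v - z|.
        by rewrite normr_gt0 subr_eq0; apply: contraNneq vu => /pinj ->.
      by exists (`|p v - z| / 2); split=> [|_]; lra.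
    by move=> v d d' _ dd' H /H; exact: le_lt_trans.
  have [r2 r20 H2] : exists2 r : R, 0 < r & forall e, e \in E -> u \notin e ->
      forall t : R, t \in `[0, 1] -> r < `|a e t - z|.
    apply: (@common_bound R {set V} (fun e r => e \in E -> u \notin e ->
      forall t : R, t \in `[0, 1] -> r < `|a e t - z|)).
      move=> e; have [eE|] := boolP (e \in E); last by exists 1.
      have [ue|ue] := boolP (u \in e); first by exists 1.
      have [ac ai im] := aE _ eE; have [a0 a1] := endp _ eE ue.
      (* The arc is compact, so its distance to [z] is attained. It is positive, since [z] is
         neither an end of the arc ([u] is not in [e]) nor an interior point of it. Half of it is a
         strict bound. *)
      have [c c01 cmin] := EVT_min ler01 (dist_arc (z := z) ac).
      have d0 : 0 < `|a e c - z|.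
        rewrite normr_gt0 subr_eq0; apply/eqP.
        have [->//|c0] := eqVneq c 0; have [->//|c1] := eqVneq c 1.
        apply: apv => //; move: c01; rewrite !in_itv /= => /andP[? ?].
        by rewrite !lt_neqAle eq_sym c0 c1; apply/andP.
      exists (`|a e c - z| / 2); split=> [|_ _ t /cmin]; lra.
    by move=> e d d' _ dd' H eE ue t t01; apply: le_lt_trans (H eE ue t t01).
  exists (Num.min r1 r2); first by rewrite lt_min r10.
  split=> [v vu|e eE ue t t01].
    by rewrite gt_min H1.
  by rewrite gt_min H2 ?orbT.
(* For each edge at [u], the straightened arc [cq.1] together with its radius [cq.2]. A total choice
   function is wanted, so other sets [e] receive the dummy value [(a e, z)]. *)
have near_u e : exists cq : (R -> R * R) * (R * R), e \in E -> u \in e ->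
    [/\ {within `[0, 1], continuous cq.1}%classic, {in `[0, 1] &, injective cq.1},
     [set cq.1 0; cq.1 1]%classic = (p @` [set` e])%classic,
     `|cq.2| = r /\ (exists2 s : R, s \in `]0, 1[ & z + cq.2 = a e s) &
     forall t : R, t \in `]0, 1[ ->
      (exists2 l : R, 0 < l <= 1 & cq.1 t = z + l *: cq.2) \/
      (r < `|cq.1 t - z| /\ exists2 s : R, s \in `]0, 1[ & cq.1 t = a e s)].
  have [eE|] := boolP (e \in E); last by exists (a e, z).
  have [ue|] := boolP (u \in e); last by exists (a e, z).
  have [ac ai im] := aE _ eE.
  have [b [bc bi b0 bim ba]] : exists b : R -> R * R,
      [/\ {within `[0, 1], continuous b}%classic, {in `[0, 1] &, injective b},
       b 0 = z, [set b 0; b 1]%classic = (p @` [set` e])%classic &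
       forall t : R, t \in `]0, 1[ -> exists2 s : R, s \in `]0, 1[ & b t = a e s].
    (* [z] is one of the two ends of the arc; if it is the second one, the arc is reversed. *)
    have : [set a e 0; a e 1]%classic z by rewrite im; exists u.
    case=> /= za; first by exists (a e); split=> // t t01; exists t.
    have [rc ri] := reverse_arc ac ai.
    exists (fun t => a e (1 - t)); split=> //; first by rewrite subr0.
      by rewrite subr0 subrr -im; apply/seteqP; split=> x /= []; auto.
    move=> t; rewrite in_itv /= => t01; exists (1 - t) => //.
    by rewrite in_itv /=; lra.
  have b01 : b 1 <> z.
    rewrite -b0 => /bi; rewrite !in_itv /= !lexx !ler01 => /(_ isT isT)/eqP.
    by rewrite oner_eq0.
  have rb1 : r < `|b 1 - z|.
    have : (p @` [set` e])%classic (b 1) by rewrite -bim; right.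
    move=> [v _ bv]; rewrite -bv; apply: rv; apply/eqP => vu.
    by apply: b01; rewrite -bv vu.
  have [c [q [cc ci [c0 c1] [qr [s s01 qs]] ct]]] := straighten_arc bc bi b0 r0 rb1.
  exists (c, q) => _ _ /=; split=> //.
  - by rewrite c0 c1 -b0.
  - by split=> //; rewrite qs; exact: ba.
  - move=> t /ct[|[rt [s' s'01 cs]]]; [by left|right; split=> //].
    by have [s2 s201 bs2] := ba _ s'01; exists s2; rewrite //= cs.
have {near_u} [cq cqP] := choice near_u.
(* The norm on the plane is the maximum norm, so every point [(r, y)] with [0 < y <= r] has norm
   [r]. Only finitely many values of [y] are second coordinates of the radii in use. *)
have [q0 q0r q0q] : exists2 q0 : R * R, `|q0| = r & forall e, q0 != (cq e).2.
  have [y /andP[y0 yr] yl] := avoid_seq [seq (cq e).2.2 | e : {set V}] r0.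
  exists (r, y).
    rewrite prod_normE /= !gtr0_norm //.
    by apply/max_idPl.
  move=> e; apply: contraNneq yl => qe.
  by apply/fintype.imageP; exists e => //; rewrite -qe.
pose p' (v : option V) := if v is Some w then p w else z + q0.
pose a' (e' : {set option V}) : R -> R * R :=
  let e := Some @^-1: e' in
  if None \in e' then fun t => z + t *: q0 else
  if u \in e then (cq e).1 else a e.
pose radius (e' : {set option V}) : R * R :=
  if None \in e' then q0 else (cq (Some @^-1: e')).2.
have NSome (e : {set V}) : None \notin Some @: e by apply/imsetP => -[].
have SomeK (e : {set V}) : Some @^-1: (Some @: e) = e.
  by apply/finset.setP => x; rewrite inE mem_imset //; exact: Some_inj.
have nz (l : R) (q : R * R) : 0 <= l -> `|q| = r -> `|z + l *: q - z| = l * r.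
  by move=> l0 qr; rewrite addrC addKr normrZ qr ger0_norm.
(* An interior point of a redrawn edge lies either on its radius, or outside the
   ball and on the old arc. *)
have interior e' t : e' \in add_leaf E u -> t \in `]0, 1[ ->
    (exists l : R, [/\ 0 < l <= 1, None \in e' -> l < 1, `|radius e'| = r,
        a' e' t = z + l *: radius e' &
        None \notin e' -> Some @^-1: e' \in E /\
        exists2 s : R, s \in `]0, 1[ & z + radius e' = a (Some @^-1: e') s]) \/
    [/\ None \notin e', Some @^-1: e' \in E, r < `|a' e' t - z| &
        exists2 s : R, s \in `]0, 1[ & a' e' t = a (Some @^-1: e') s].
  rewrite finset.in_setU1 => /orP[/eqP ->|/imsetP[e eE ->]] t01.
    left; exists t; rewrite /a' /radius !inE eqxx /=; move: t01.
    by rewrite in_itv /= => /andP[t0 t1]; split=> //; rewrite t0 ltW.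
  rewrite /a' /radius (negPf (NSome e)) SomeK; have [ue|ue] := boolP (u \in e).
    have [_ _ _ [qr qs] /(_ t t01)[[l l01 cl]|]] := cqP e eE ue; last first.
      by move=> [? ?]; right; split.
    by left; exists l; split.
  right; split=> //; first by apply: re => //; rewrite !in_itv /= in t01 *; lra.
  by exists t.
have r_l (l : R) : 0 < l -> l <= 1 -> 0 < l * r /\ l * r <= r.
  by move=> l0 l1; rewrite mulr_gt0 // ler_piMl // ltW.
exists p', a'; split.
- have pN w : z + q0 <> p w.
    move=> E0; have [wu|/rv] := eqVneq w u.
      by move: r0; rewrite -q0r -(addKr z q0) E0 wu /z addNr normr0 ltxx.
    by rewrite -E0 addrC addKr q0r ltxx.
  by move=> [v|] [w|] //= => [/pinj -> //|/esym/pN|/pN].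
- move=> e'; rewrite finset.in_setU1 => /orP[/eqP ->|/imsetP[e eE ->]].
    rewrite /a' !inE eqxx /=; split.
    + exact: (@continuous_subspaceT R (R * R)%type _ _ (@radius_continuous _ _ _)).
    + move=> s t _ _ /addrI/eqP; rewrite -subr_eq0 -scalerBl scaler_eq0.
      by move=> /orP[|/eqP qz]; [rewrite subr_eq0 => /eqP|move: r0; rewrite -q0r qz normr0 ltxx].
    + rewrite scale0r addr0 scale1r; apply/seteqP; split=> x /=.
        by move=> [->|->]; [exists (Some u)|exists None] => //=; rewrite !inE eqxx ?orbT.
      by move=> [[v|]]; rewrite !inE /=; [move=> /eqP[->] <-; left|move=> _ <-; right].
  have -> : (p' @` [set` (Some @: e)])%classic = (p @` [set` e])%classic.
    apply/seteqP; split=> x /= [v].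
      by move=> /imsetP[w we ->] <-; exists w.
    by move=> ve <-; exists (Some v) => //=; apply: imset_f.
  rewrite /a' (negPf (NSome e)) SomeK; have [ue|ue] := boolP (u \in e).
    by have [] := cqP e eE ue.
  exact: aE.
- move=> e' t v' e'E t01; case: (interior e' t e'E t01).
    move=> [l [/andP[l0 l1] lN qr -> He]] E0.
    have := nz l _ (ltW l0) qr; rewrite E0; have [lr0 lr1] := r_l l l0 l1.
    case: v' E0 => [w|] E0 /=.
      have [->|/rv] := eqVneq w u; first by rewrite /z subrr normr0; lra.
      by move=> + E1; rewrite E1; lra.
    rewrite addrC addKr q0r => rlr.
    (* The new leaf lies at distance exactly [r], so a point of a radius can meet it only at the far
       end. The new edge excludes [l = 1] in its interior, and every other edge has a radius
       different from [q0]. *)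
    have l1' : l = 1.
      apply/eqP; rewrite -(inj_eq (mulIf (lt0r_neq0 r0))) mul1r; exact/eqP.
    have Ne' : None \notin e'.
      by apply/negP => /lN; rewrite l1' ltxx.
    move: E0; rewrite /= l1' scale1r => /addrI; rewrite /radius (negPf Ne').
    by move/esym/eqP; rewrite (negPf (q0q _)).
  move=> [Ne' eE far [s s01 as']]; case: v' => [w|] /=.
    by rewrite as'; exact: apv.
  by move=> E0; move: far; rewrite E0 addrC addKr q0r ltxx.
have radiusN e' f' : e' \in add_leaf E u -> f' \in add_leaf E u -> e' != f' ->
   None \in e' -> None \notin f'.
  move=> e'E f'E ef; apply: contraTN.
  move: e'E f'E ef; rewrite !finset.in_setU1.
  case/orP=> [/eqP->|/imsetP[e _ ->] _ _ _]; last exact: NSome.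
  by case/orP=> [/eqP->|/imsetP[e _ ->] _ /(negP (NSome e))]; rewrite ?eqxx.
have SomeE e' : e' \in add_leaf E u -> None \notin e' -> e' = Some @: (Some @^-1: e').
  rewrite finset.in_setU1 => /orP[/eqP ->|/imsetP[e eE ->] _]; last by rewrite SomeK.
  by rewrite !inE eqxx.
move=> e' f' s t e'E f'E ef s01 t01 E0.
have := interior e' s e'E s01; have := interior f' t f'E t01; rewrite -E0.
move=> [[l [/andP[l0 l1] lN qr El Hf]]|[Nf fE ffar [s' s'01 as']]];
move=> [[m [/andP[m0 m1] mN qr' Em He]]|[Ne eE efar [t' t'01 at']]].
- have lm : l = m.
    apply: (mulIf (lt0r_neq0 r0)).
    by rewrite -(nz l _ (ltW l0) qr) -(nz m _ (ltW m0) qr') -El -Em.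
  move: Em; rewrite El lm => /addrI/(scalerI (lt0r_neq0 m0)) rad.
  have [Ne|Ne] := boolP (None \in e').
    have Nf := radiusN _ _ e'E f'E ef Ne.
    by move/esym/eqP: rad; rewrite /radius Ne (negPf Nf) (negPf (q0q _)).
  have [Nf|Nf] := boolP (None \in f').
    by move/eqP: rad; rewrite /radius Nf (negPf Ne) (negPf (q0q _)).
  have [eE [s1 s101 es1]] := He Ne; have [fE [t1 t101 ft1]] := Hf Nf.
  apply: (aef _ _ s1 t1 eE fE) => //.
    by apply: contraNneq ef => e'f'; rewrite (SomeE _ e'E Ne) e'f' -(SomeE _ f'E Nf).
  by rewrite -es1 -ft1 rad.
- by move: efar; rewrite El nz // ?(ltW l0) //; have := r_l l l0 l1; lra.
- by move: ffar; rewrite Em nz // ?(ltW m0) //; have := r_l m m0 m1; lra.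
- apply: (aef _ _ t' s' eE fE) => //; last by rewrite -at' -as'.
  by apply: contraNneq ef => e'f'; rewrite (SomeE _ e'E Ne) e'f' -(SomeE _ f'E Nf).
Qed.

(** * Deleting leaves and relabelling vertices *)

From mathcomp Require Import finset.

Section AddLeafTheory.
Variable V : finType.
Implicit Types (E : {set {set V}}) (u v : V).

Lemma Some_in_add_leaf E u (e : {set V}) : (Some @: e \in add_leaf E u) = (e \in E).
Proof.
rewrite in_setU1 (mem_imset _ _ (imset_inj Some_inj)) orbC.
have [//|eE] := boolP (e \in E); apply/eqP => eN.
have : None \in [set None; Some u] by rewrite !inE eqxx.
by rewrite -eN => /imsetP[].
Qed.

Lemma adj_add_leaf_Some E u v w :
  adj (add_leaf E u) (Some v) (Some w) = adj E v w.
Proof. by rewrite /adj /= -(Some_in_add_leaf E u) imsetU1 imset_set1. Qed.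

Lemma adj_add_leaf_NoneSome E u w : adj (add_leaf E u) None (Some w) = (w == u).
Proof.
rewrite /adj /= in_setU1; have [->|wu] := eqVneq w u; first by rewrite eqxx.
apply/negbTE; rewrite negb_or; apply/andP; split.
  apply: contraNneq wu => /setP/(_ (Some w)).
  by rewrite !inE eqxx orbT => /esym/eqP[->].
apply/imsetP => -[e _ /setP/(_ None)]; rewrite !inE eqxx /= => /esym/imsetP[] //.
Qed.

Lemma adjC (W : finType) (E : {set {set W}}) x y : adj E x y = adj E y x.
Proof. by rewrite /adj /= setUC. Qed.

Lemma adj_irrefl (W : finType) (E : {set {set W}}) x : simple_graph E -> adj E x x = false.
Proof.
move=> /forall_inP E2; apply/negbTE/negP => /E2.
by rewrite cards2 eqxx.
Qed.

Lemma adj_add_leaf_NoneNone E u : adj (add_leaf E u) None None = false.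
Proof.
rewrite /adj /= in_setU1; apply/negbTE; rewrite negb_or; apply/andP; split.
  by apply/eqP => /setP/(_ (Some u)); rewrite !inE eqxx.
apply/imsetP => -[e _ /setP/(_ None)]; rewrite !inE eqxx /= => /esym/imsetP[] //.
Qed.

Lemma simple_add_leaf E u : simple_graph (add_leaf E u) = simple_graph E.
Proof.
apply/forall_inP/forall_inP => H e.
  rewrite -(Some_in_add_leaf _ u) => /H; rewrite card_imset //; exact: Some_inj.
rewrite in_setU1 => /orP[/eqP->|/imsetP[e' /H e2 ->]]; first by rewrite cards2.
by rewrite card_imset //; exact: Some_inj.
Qed.

Lemma degree_add_leaf_None E u : degree (add_leaf E u) None = 1%N.
Proof.
rewrite /degree (_ : [set _ | _] = [set Some u]) ?cards1 //.
apply/setP => -[w|]; rewrite !inE ?adj_add_leaf_NoneNone //.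
by rewrite adj_add_leaf_NoneSome (inj_eq Some_inj).
Qed.

Lemma degree_add_leaf_Some E u v :
  degree (add_leaf E u) (Some v) = (degree E v + (v == u))%N.
Proof.
rewrite /degree -[in RHS](card_imset _ Some_inj).
have -> : nat_of_bool (v == u) = #|[set x : option V | (v == u) && (x == None)]|.
  have [_|_] := eqVneq v u; last first.
    by rewrite (_ : [set _ | _] = set0) ?cards0 //; apply/setP => x; rewrite !inE.
  by rewrite (_ : [set _ | _] = [set None]) ?cards1 //; apply/setP => x; rewrite !inE.
rewrite -[in RHS]cardsUI (_ : _ :&: _ = set0) ?cards0 ?addn0; last first.
  apply/setP => -[x|]; rewrite !inE ?andbF //.
  by case: imsetP => // -[].
apply: eq_card => -[w|]; rewrite !inE ?eqxx ?andbT.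
  rewrite (_ : (Some w == None) = false) // andbF orbF.
  by rewrite adj_add_leaf_Some (mem_imset _ _ Some_inj) inE.
rewrite adjC adj_add_leaf_NoneSome orbC; case: imsetP => [[]|_] //.
by rewrite orbF.
Qed.

Lemma connected_add_leaf E u : connected_graph (add_leaf E u) = connected_graph E.
Proof.
rewrite /connected_graph !card_option /= (_ : 0 < #|V|)%N; last by apply/card_gt0P; exists u.
apply/forallP/forallP => H x; apply/forallP.
  (* [h] folds the leaf onto its neighbour, so each edge of a path becomes an edge of [E] or
     collapses to a point. *)
  pose h (y : option V) := odflt u y.
  have hom x' y : connect (adj (add_leaf E u)) x' y -> connect (adj E) (h x') (h y).
    move=> /connectP[p]; elim: p x' => [|b p IH] a /= => [_ -> //|/andP[ab pp] yE].
    apply: connect_trans (IH _ pp yE).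
    case: a b ab {pp yE} => [a|] [b|] /=.
    - by rewrite adj_add_leaf_Some; exact: connect1.
    - by rewrite adjC adj_add_leaf_NoneSome => /eqP ->.
    - by rewrite adj_add_leaf_NoneSome => /eqP ->.
    - by rewrite adj_add_leaf_NoneNone.
  by move=> y; have /forallP/(_ (Some y))/hom := H (Some x).
have hom a b : connect (adj (add_leaf E u)) (Some a) (Some b).
  have /forallP/(_ b)/connectP[p pp ->] := H a.
  apply/connectP; exists (map Some p); last by rewrite last_map.
  by elim: p a pp => //= c p IH a /andP[ac /IH ->]; rewrite adj_add_leaf_Some ac.
have Nu : connect (adj (add_leaf E u)) None (Some u).
  by apply: connect1; rewrite /= adj_add_leaf_NoneSome.
have uN : connect (adj (add_leaf E u)) (Some u) None.
  by apply: connect1; rewrite /= adjC adj_add_leaf_NoneSome.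
move=> y; case: x y => [x|] [y|]; [exact: hom| | |exact: connect0].
  exact: connect_trans (hom x u) uN.
exact: connect_trans Nu (hom u y).
Qed.

Lemma planar_add_leafE (R : realType) E u :
  planar (add_leaf E u) R <-> planar E R.
Proof.
split; last exact: planar_add_leaf.
by apply: (planar_inj Some_inj) => e eE; rewrite Some_in_add_leaf.
Qed.

Lemma add_leaf_inj E E' u u' : add_leaf E u = add_leaf E' u' -> E = E' /\ u = u'.
Proof.
move=> EE; split.
  by apply/setP => e; rewrite -(Some_in_add_leaf E u) EE Some_in_add_leaf.
by apply/eqP; rewrite -(adj_add_leaf_NoneSome E' u') -EE adj_add_leaf_NoneSome.
Qed.

(** Edges have two elements and [None] has the single neighbour [Some u], so [[set None; Some u]] is
    the only edge through [None]. All others are images under [Some]. *)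
Lemma leaf_add_leaf (E : {set {set option V}}) :
  simple_graph E -> degree E None = 1%N -> exists E' u, E = add_leaf E' u.
Proof.
move=> sE /eqP; rewrite /degree => /cards1P[[u|] Nu]; last first.
  have : None \in [set u | adj E None u] by rewrite Nu inE.
  by rewrite inE adj_irrefl.
exists [set e : {set V} | Some @: e \in E], u; apply/setP => e.
have Ny y : (adj E None y) = (y == Some u) by have /setP/(_ y) := Nu; rewrite !inE.
rewrite in_setU1; have [Ne|Ne] := boolP (None \in e).
  transitivity (e == [set None; Some u]).
    apply/idP/eqP => [eE|->]; last by have := Ny (Some u); rewrite eqxx.
    have /cards2P[x [y [xy exy]]] : #|e| == 2 by exact: (forall_inP sE).
    rewrite exy !inE in Ne eE *; case/orP: Ne => /eqP Ne.
      by have := Ny y; rewrite /adj /= Ne eE => /esym/eqP ->.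
    by have := Ny x; rewrite /adj /= Ne setUC eE => /esym/eqP ->; rewrite setUC.
  case: eqP => //= _; apply/esym/negbTE/imsetP => -[e' _ ee'].
  by move: Ne; rewrite ee' => /imsetP[].
have -> : e = Some @: (Some @^-1: e).
  apply/setP => -[x|]; last by rewrite (negPf Ne); apply/esym/negbTE/imsetP => -[].
  by rewrite (mem_imset _ _ Some_inj) inE.
rewrite (mem_imset _ _ (imset_inj Some_inj)) inE.
case: eqP => //= /setP/(_ None); rewrite !inE eqxx /= => /imsetP[] //.
Qed.

End AddLeafTheory.

(** The class [connected_planar] over any finite vertex type, since deleting a leaf leads from
    [option V] to [V]. *)
Definition conn_planar (R : realType) (V : finType) (E : {set {set V}}) : bool :=
  [&& simple_graph E, connected_graph E & `[< planar E R >]].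

(** The root [r] may be a leaf or not; a graph without leaves qualifies with every root. *)
Definition only_leaf (V : finType) (E : {set {set V}}) (r : V) : bool :=
  [forall s, (degree E s == 1%N) ==> (s == r)].

Lemma conn_planar_add_leaf (R : realType) (V : finType) (E : {set {set V}}) u :
  conn_planar R (add_leaf E u) = conn_planar R E.
Proof.
rewrite /conn_planar simple_add_leaf connected_add_leaf.
congr [&& _, _ & _].
by apply: asbool_equiv_eq; exact: planar_add_leafE.
Qed.

Lemma degree_gt0 (V : finType) (E : {set {set V}}) (x y : V) :
  connected_graph E -> x != y -> (0 < degree E x)%N.
Proof.
move=> /andP[_ /forallP/(_ x)/forallP/(_ y)/connectP[[|z p] /= pp yE]].
  by rewrite yE eqxx.
by move=> _; apply/card_gt0P; exists z; rewrite inE; case/andP: pp.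
Qed.

(** * Invariance under bijections of the vertex set *)

Section Relabel.
Variables (V V' : finType) (f : V -> V').
Hypothesis fbij : bijective f.

Definition relabel (E : {set {set V}}) : {set {set V'}} :=
  [set f @: e | e : {set V} in E].

Let finj : injective f := bij_inj fbij.

Lemma relabel_bij : bijective relabel.
Proof.
have imset_bij (T T' : finType) (h : T -> T') : bijective h ->
    bijective (fun A : {set T} => h @: A).
  move=> [g hK gK]; exists (fun A : {set T'} => g @: A) => A;
    by rewrite -imset_comp (eq_imset _ (g := id)) ?imset_id.
exact/imset_bij/imset_bij.
Qed.

Lemma mem_relabel E (e : {set V}) : (f @: e \in relabel E) = (e \in E).
Proof. by rewrite mem_imset //; exact: imset_inj. Qed.

Lemma adj_relabel E x y : adj (relabel E) (f x) (f y) = adj E x y.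
Proof. by rewrite /adj /= -(mem_relabel E) imsetU1 imset_set1. Qed.

Lemma degree_relabel E x : degree (relabel E) (f x) = degree E x.
Proof.
rewrite /degree -(card_imset _ finj); apply: eq_card => y'.
have [g _ gK] := fbij; rewrite -(gK y') (mem_imset _ _ finj) !inE.
exact: adj_relabel.
Qed.

Lemma conn_planar_relabel (R : realType) E :
  conn_planar R (relabel E) = conn_planar R E.
Proof.
have [g fK gK] := fbij; have ginj := can_inj gK.
have memg (e : {set V'}) : (g @: e \in E) = (e \in relabel E).
  by rewrite -mem_relabel -imset_comp (eq_imset _ (g := id)) ?imset_id.
congr [&& _, _ & _].
- apply/forall_inP/forall_inP => H e.
    by rewrite -mem_relabel => /H; rewrite card_imset.
  by rewrite -memg => /H; rewrite card_imset.
- rewrite /connected_graph (bij_eq_card fbij); congr (_ && _).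
  have adjg x y : adj (relabel E) x y = adj E (g x) (g y).
    by rewrite -adj_relabel !gK.
  have hom (T T' : finType) (e : rel T) (e' : rel T') (h : T -> T') :
      (forall x y, e x y -> e' (h x) (h y)) ->
      forall x y, connect e x y -> connect e' (h x) (h y).
    move=> eh x y /connectP[p pp ->]; apply/connectP; exists (map h p).
      by apply: homo_path pp.
    by rewrite last_map.
  apply/forallP/forallP => H x; apply/forallP => y.
    have /forallP/(_ (f y)) := H (f x); rewrite -{2}(fK x) -{2}(fK y).
    by apply: hom => {}x {}y; rewrite adjg.
  have /forallP/(_ (g y)) := H (g x); rewrite -{2}(gK x) -{2}(gK y).
  by apply: hom => {}x {}y; rewrite adj_relabel.
- apply: asbool_equiv_eq; split.
    by apply: planar_inj finj _ => e; rewrite mem_relabel.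
  by apply: planar_inj ginj _ => e; rewrite memg.
Qed.

Lemma only_leaf_relabel E r : only_leaf (relabel E) (f r) = only_leaf E r.
Proof.
have [g fK gK] := fbij; apply/forallP/forallP => H s.
  by rewrite -degree_relabel -(inj_eq finj).
by rewrite -(gK s) degree_relabel inj_eq.
Qed.

Lemma sum_relabel (A : nmodType) (P : pred {set {set V'}}) (F : {set {set V'}} -> A) :
  \sum_(E | P E) F E = \sum_(E | P (relabel E)) F (relabel E).
Proof. by apply: reindex; apply: onW_bij; exact: relabel_bij. Qed.

End Relabel.

Section PickVertex.
Variables (V : finType) (s : V).

(** Puts a chosen vertex [s] in the position of [None], so that the results on the leaf [None] apply
    to any vertex. *)
Definition pick_vertex (x : option {x : V | x != s}) : V := oapp val s x.

Lemma pick_vertex_bij : bijective pick_vertex.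
Proof.
exists (fun x => insub x) => [[x|]|x] /=.
- by rewrite valK.
- by rewrite insubN // eqxx.
- by case: insubP => [u _ <-|] //=; rewrite negbK => /eqP.
Qed.

Lemma card_pick_vertex : #|{: {x : V | x != s}}| = #|V|.-1.
Proof. by rewrite card_sig cardC1. Qed.

End PickVertex.

(** Graphs in which [None] is a leaf correspond bijectively, through [add_leaf], to pairs of a
    smaller graph and a vertex of it. *)
Lemma sum_leaf (R : realType) (V : finType) (A : nmodType)
    (F : {set {set option V}} -> A) :
  \sum_(E | conn_planar R E && (degree E None == 1%N)) F E =
  \sum_(E : {set {set V}} | conn_planar R E) \sum_u F (add_leaf E u).
Proof.
rewrite pair_big_dep /=; pose h (x : {set {set V}} * V) := add_leaf x.1 x.2.
rewrite -(big_imset (h := h) F (A := [pred x | conn_planar R x.1 && true])).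
  apply: eq_bigl => E; apply/andP/imsetP => [[KE /eqP E1]|[[E' u] /=]].
    have [sE _] := andP KE; have [E' [u EE]] := leaf_add_leaf sE E1.
    by exists (E', u) => //=; rewrite inE andbT -(conn_planar_add_leaf R E' u) -EE.
  rewrite inE andbT => KE ->; rewrite conn_planar_add_leaf; split=> //.
  by rewrite degree_add_leaf_None.
by move=> [E u] [E' u'] _ _ /add_leaf_inj /= [-> ->].
Qed.

(** * Inclusion-exclusion over sets of marked leaves *)

Lemma big_optionS (A : nmodType) (V : finType) (P : pred (option V)) (F : option V -> A) :
  ~~ P None -> \sum_(x | P x) F x = \sum_(v | P (Some v)) F (Some v).
Proof.
move=> PN; have inj : {in [pred v | P (Some v)] &, injective (@Some V)}.
  by move=> v w _ _ [].
rewrite -(big_imset F inj); apply: eq_bigl => -[v|].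
  by rewrite mem_imset ?inE //; exact: Some_inj.
by rewrite (negPf PN); apply/esym/negbTE/imsetP => -[].
Qed.

Section MarkedLeaves.
Variables (R : realType) (A : comNzRingType) (a : A).

(* The vertices of S are marked leaves, other than the root. *)
Definition marked_sum (V : finType) (S : {set V}) : A :=
  \sum_(E : {set {set V}} | conn_planar R E)
    \sum_(r | (r \notin S) && [forall s in S, degree E s == 1%N]) a ^+ degree E r.

Lemma marked_sum_relabel (V V' : finType) (f : V -> V') (S : {set V'}) :
  bijective f -> marked_sum S = marked_sum (f @^-1: S).
Proof.
move=> fbij; rewrite /marked_sum (sum_relabel fbij).
apply: eq_big => E; first by rewrite conn_planar_relabel.
move=> _; rewrite (reindex f) /=; last exact: onW_bij.
apply: eq_big => r; last by rewrite degree_relabel.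
rewrite inE; congr (_ && _); have [g fK gK] := fbij.
apply/forall_inP/forall_inP => H s sS.
  by rewrite -(degree_relabel fbij); apply: H; rewrite inE in sS.
by rewrite -(gK s) degree_relabel //; apply: H; rewrite inE gK.
Qed.

(** Delete the marked leaf [None]. Its neighbour is an unmarked vertex: the root, whose degree drops
    by one and which yields the factor [a], or one of the other unmarked vertices, each yielding
    [1]. *)
Lemma marked_sum_leaf (V : finType) (S : {set option V}) : None \in S ->
  marked_sum S = marked_sum (Some @^-1: S) *
    (#|~: (Some @^-1: S : {set V})|%:R - 1 + a).
Proof.
move=> NS; set S' : {set V} := Some @^-1: S; rewrite /marked_sum.
rewrite (bigID (fun E => degree E None == 1%N)) /= [X in _ + X]big1 ?addr0; last first.
  move=> E /andP[_ EN]; rewrite big_pred0 // => r; apply: contraNF EN => /andP[_].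
  by move/forall_inP; apply.
rewrite sum_leaf mulr_suml; apply: eq_bigr => E /and3P[sE cE _].
pose good r := (r \notin S') && [forall s in S', degree E s == 1%N].
have goodE u r :
    (Some r \notin S) && [forall s in S, degree (add_leaf E u) s == 1%N] =
    good r && (u \notin S').
  rewrite /good inE; have [rS|rS] := boolP (Some r \in S) => //=.
  apply/forall_inP/andP => [H|[/forall_inP H uS] [s|] sS].
  (* If the neighbour [u] were a marked leaf too, it would be isolated in [E], which is connected
     and also contains [r]. *)
  - have uS : u \notin S'.
      apply/negP => uS; have := H (Some u); rewrite inE in uS.
      rewrite degree_add_leaf_Some eqxx addn1 eqSS => /(_ uS).
      have ur : u != r by apply: contraNneq rS => <-.
      by rewrite gtn_eqF // (degree_gt0 cE ur).
    split=> //; apply/forall_inP => s sS.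
    have := H (Some s); rewrite inE in sS; rewrite degree_add_leaf_Some.
    rewrite (_ : (s == u) = false) ?addn0; first by apply.
    by apply: contraNF uS => /eqP <-; rewrite inE.
  - rewrite degree_add_leaf_Some (_ : (s == u) = false) ?addn0.
      by apply: H; rewrite inE.
    by apply: contraNF uS => /eqP <-; rewrite inE.
  - by rewrite degree_add_leaf_None.
transitivity (\sum_u \sum_(r | good r && (u \notin S')) a ^+ degree E r * a ^+ (r == u)).
  apply: eq_bigr => u _; rewrite big_optionS ?NS //.
  apply: eq_big => r; first exact: goodE.
  by rewrite degree_add_leaf_Some exprD.
rewrite (exchange_big_dep good) /=; last by move=> u r _ /andP[].
rewrite mulr_suml; apply: eq_bigr => r /[dup] gr /andP[rS _].
under eq_bigl do rewrite gr /=.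
rewrite -mulr_sumr; congr (_ * _).
rewrite (bigD1 r) //= eqxx expr1 [LHS]addrC; congr (_ + _).
rewrite (eq_bigr (fun=> 1)); last by move=> u /andP[_ /negPf ur]; rewrite eq_sym ur.
rewrite sumr_const (cardsD1 r (~: S')) inE rS natrD [RHS]addrC addKr.
by congr _%:R; apply: eq_card => u; rewrite [LHS]unfold_in !inE andbC.
Qed.

(** The marked leaves are deleted one by one. The number of unmarked vertices stays [k.+1], so every
    deletion contributes the same factor [k%:R + a]. *)
Lemma marked_sumE (V : finType) (S : {set V}) (m k : nat) :
  #|S| = m -> #|V| = (m + k.+1)%N ->
  marked_sum S = marked_sum (set0 : {set 'I_k.+1}) * (k%:R + a) ^+ m.
Proof.
elim: m V S => [|m IH] V S Sm Vk.
  rewrite expr0 mulr1; move/eqP: Sm; rewrite cards_eq0 => /eqP ->.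
  have fbij : bijective (enum_val \o cast_ord (esym Vk) : 'I_k.+1 -> V).
    apply: bij_comp; first exact: enum_val_bij.
    by exists (cast_ord Vk) => i; apply: val_inj.
  by rewrite (marked_sum_relabel _ fbij) preimset0.
have /card_gt0P[s sS] : (0 < #|S|)%N by rewrite Sm.
rewrite (marked_sum_relabel _ (pick_vertex_bij s)) marked_sum_leaf ?inE //.
set S' : {set _} := Some @^-1: _.
have cW : #|{: {x : V | x != s}}| = (m + k.+1)%N by rewrite card_pick_vertex Vk.
have cS : #|S'| = m.
  apply/eqP; rewrite -eqSS -Sm (cardsD1 s S) sS add1n eqSS; apply/eqP.
  rewrite -(card_imset _ val_inj); apply: eq_card => x; rewrite !inE.
  apply/imsetP/andP => [[y]|[xs xS]].
    by rewrite !inE => yS ->; rewrite (valP y).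
  by exists (Sub x xs) => //; rewrite !inE.
rewrite (IH _ _ cS cW) exprSr mulrA; congr (_ * (_ + _)).
by rewrite cardsCs setCK cS cW addKn -natr1 addrK.
Qed.

End MarkedLeaves.

(** Expand the product over all [i] of [(if i \in B then -1 else 0) + 1]: every element of [B] gives
    a zero factor, and the sets not contained in [B] give zero terms. *)
Lemma sum_sign_subset (A : comNzRingType) (T : finType) (B : {set T}) :
  \sum_(S : {set T} | S \subset B) (-1) ^+ #|S| = (B == set0)%:R :> A.
Proof.
have /= := bigA_distr (1 : A) +%R (fun i => if i \in B then -1 else 0) (fun=> 1).
move=> sumE; transitivity (\prod_i ((if i \in B then -1 else 0) + 1) : A).
  rewrite sumE big_mkcond; apply: eq_bigr => S _; rewrite -big_mkcond /=.
  case: ifP => [SB|/negbT/fintype.subsetPn[x xS xB]].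
    rewrite (eq_bigr (fun=> -1)) ?prodr_const //.
    by move=> i iS; rewrite (fintype.subsetP SB).
  by rewrite (bigD1 x) //= (negPf xB) mul0r.
have [->|/set0Pn[x xB]] := eqVneq B set0.
  by rewrite big1 // => i _; rewrite inE add0r.
by rewrite (bigD1 x) //= xB addNr mul0r.
Qed.

(** * Sieving out the leaves other than the root *)

Section Sieve.
Variables (R : realType) (A : comNzRingType) (a : A).

Definition only_leaf_sum (V : finType) : A :=
  \sum_(E : {set {set V}} | conn_planar R E)
    \sum_(r | only_leaf E r) a ^+ degree E r.

Lemma only_leaf_sum_relabel (V V' : finType) (f : V -> V') : bijective f ->
  only_leaf_sum V' = only_leaf_sum V.
Proof.
move=> fbij; rewrite /only_leaf_sum (sum_relabel fbij).
apply: eq_big => E; first by rewrite conn_planar_relabel.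
move=> _; rewrite (reindex f) /=; last exact: onW_bij.
by apply: eq_big => r; rewrite ?only_leaf_relabel // degree_relabel.
Qed.

(** For a fixed graph and root [r], the admissible sets [S] are the subsets of the set [B] of leaves
    other than [r]. Their signs cancel unless [B] is empty. *)
Lemma only_leaf_sum_sieve (V : finType) :
  only_leaf_sum V = \sum_(S : {set V}) (-1) ^+ #|S| * marked_sum R a S.
Proof.
under [RHS]eq_bigr do rewrite mulr_sumr.
rewrite exchange_big /=; apply: eq_bigr => E _.
under [RHS]eq_bigr do rewrite mulr_sumr big_mkcond.
rewrite exchange_big /= big_mkcond /=; apply: eq_bigr => r _.
pose B := [set s | (degree E s == 1%N) && (s != r)].
have SB (S : {set V}) :
    (r \notin S) && [forall s in S, degree E s == 1%N] = (S \subset B).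
  apply/andP/fintype.subsetP => [[rS /forall_inP H] s sS|SB].
    by rewrite inE H //; apply: contraNneq rS => <-.
  split; first by apply/negP => /SB; rewrite inE eqxx andbF.
  by apply/forall_inP => s /SB; rewrite inE => /andP[].
under eq_bigr do rewrite SB.
rewrite -big_mkcond -mulr_suml sum_sign_subset.
have -> : (B == set0) = only_leaf E r.
  apply/eqP/forallP => [B0 s|H].
    by apply/implyP => s1; apply: contraFT (in_set0 s); rewrite -B0 inE s1.
  apply/setP => s; rewrite !inE; have := H s; case: (degree E s == 1%N) => //= ->.
  by [].
by case: ifP; rewrite ?mul1r ?mul0r.
Qed.

(** The sets [S] are grouped by size: [k.+1] vertices are unmarked, [n - k] are marked, and the sign
    is absorbed into the power. *)
Lemma only_leaf_sumE (n : nat) :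
  only_leaf_sum 'I_n.+1 =
  \sum_(k < n.+1) 'C(n.+1, k.+1)%:R * (- (k%:R + a)) ^+ (n - k) *
    marked_sum R a (set0 : {set 'I_k.+1}).
Proof.
rewrite only_leaf_sum_sieve.
have cI (S : {set 'I_n.+1}) : (#|S| < n.+2)%N by rewrite ltnS -[leqRHS]card_ord max_card.
rewrite (partition_big (fun S : {set 'I_n.+1} => Ordinal (cI S)) xpredT) //=.
(* The last term marks every vertex and leaves no place for the root. *)
rewrite big_ord_recr /= [X in _ + X]big1 ?addr0; last first.
  move=> S /eqP[SE]; rewrite /marked_sum big1 ?mulr0 // => E _.
  rewrite big_pred0 // => r; apply/negbTE; rewrite negb_and negbK.
  have /eqP -> : S == setT by rewrite eqEcard finset.subsetT cardsT card_ord SE ltnSn.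
  by rewrite inE.
rewrite (reindex_inj rev_ord_inj) /=; apply: eq_bigr => k _.
have kn : (k <= n)%N by rewrite -ltnS.
rewrite (eq_bigr (fun=> (-1) ^+ (n - k) *
    (marked_sum R a (set0 : {set 'I_k.+1}) * (k%:R + a) ^+ (n - k)))).
  rewrite sumr_const (_ : #|_| = 'C(n.+1, k.+1)).
    by rewrite [in RHS]exprNn -mulr_natl; ring.
  have -> : 'C(n.+1, k.+1) = #|[set S : {set 'I_n.+1} | #|S| == (n - k)%N]|.
    by rewrite card_draws card_ord -bin_sub // subSS.
  apply: eq_card => S; rewrite !inE unfold_in.
  by rewrite -[LHS]/(_ == _ :> nat) /= subSS.
move=> S /eqP[]; rewrite subSS => SE; rewrite SE (marked_sumE R a (m := n - k) (k := k)) //.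
by rewrite card_ord addnS subnK.
Qed.

Lemma only_leaf_sum0 : only_leaf_sum 'I_0 = 0.
Proof.
rewrite /only_leaf_sum big_pred0 // => E.
by rewrite /conn_planar /connected_graph card_ord ltnn /= andbF.
Qed.

End Sieve.

(** * Graphs without leaves other than the root *)

(** If there is a second vertex, then [u] has positive degree in [E], so with the new leaf its
    degree is at least two and only the other vertices of [E] matter. If [u] is alone, it becomes a
    second leaf. *)
Lemma only_leaf_add_leaf (V : finType) (E : {set {set V}}) (u : V) :
  simple_graph E -> connected_graph E ->
  only_leaf (add_leaf E u) None = (1 < #|V|)%N && only_leaf E u.
Proof.
move=> sE cE; have [V1|V1] := ltnP 1 #|V|; last first.
  apply/negbTE/forallPn; exists (Some u).
  rewrite negb_imply degree_add_leaf_Some eqxx addn1 eqSS andbT.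
  rewrite cards_eq0; apply/eqP/setP => v; rewrite !inE.
  by rewrite (fintype_le1P V1 v u) adj_irrefl.
have [v vu] : exists v, u != v.
  have /card_gt1P[x [y [_ _ xy]]] := V1.
  by have [ux|] := eqVneq u x; [exists y; rewrite ux|exists x].
have du := degree_gt0 cE vu.
apply/forallP/forallP => H s.
  apply/implyP => /eqP s1; apply: contraT => su.
  by have := H (Some s); rewrite degree_add_leaf_Some s1 (negPf su).
case: s => [s|]; last by rewrite eqxx implybT.
rewrite degree_add_leaf_Some; have [->|su] := eqVneq s u.
  by rewrite addn1 eqSS gtn_eqF.
by have := H s; rewrite addn0 (negPf su) implybF => /negPf ->.
Qed.

Lemma degree_single (E : {set {set 'I_1}}) (r : 'I_1) :
  simple_graph E -> degree E r = 0%N.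
Proof.
move=> sE; apply/eqP; rewrite cards_eq0; apply/eqP/setP => v; rewrite !inE.
by rewrite (ord1 v) (ord1 r) adj_irrefl.
Qed.

Lemma simple_single (E : {set {set 'I_1}}) : simple_graph E = (E == set0).
Proof.
apply/idP/eqP => [/forall_inP E2|->]; last by apply/forall_inP => e; rewrite inE.
apply/setP => e; rewrite inE; apply/negP => /E2 /eqP e2.
by have := max_card e; rewrite e2 card_ord.
Qed.

Lemma conn_planar_single (R : realType) (E : {set {set 'I_1}}) :
  conn_planar R E = (E == set0).
Proof.
rewrite /conn_planar simple_single; case: eqP => //= ->.
apply/andP; split.
  rewrite /connected_graph card_ord; apply/forallP => x; apply/forallP => y.
  by rewrite (ord1 x) (ord1 y) connect0.
apply/asboolP; exists (fun=> (0, 0)), (fun _ _ => (0, 0)); split.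
- by move=> x y; rewrite (ord1 x) (ord1 y).
- by move=> e; rewrite inE.
- by move=> e t v; rewrite inE.
- by move=> e g s t; rewrite inE.
Qed.

(** * Splitting according to whether the root is a leaf *)

Section Recurrence.
Variables (R : realType) (A : comNzRingType).

Definition two_graph_sum (a : A) (V : finType) : A :=
  \sum_(E : {set {set V}} | two_graph E && `[< planar E R >])
    \sum_r a ^+ degree E r.

Lemma only_leaf_sum1 (a : A) : only_leaf_sum R a 'I_1 = 1.
Proof.
rewrite /only_leaf_sum; under eq_bigl do rewrite conn_planar_single.
have s0 : simple_graph (set0 : {set {set 'I_1}}) by rewrite simple_single.
rewrite big_pred1_eq (big_pred1 ord0) ?degree_single // => r.
rewrite (ord1 r) [RHS]eqxx; apply/forallP => s.
by rewrite degree_single.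
Qed.

Lemma two_graph_sum_single (a : A) : two_graph_sum a 'I_1 = 0.
Proof.
apply: big_pred0 => E; apply/negbTE; rewrite negb_and; apply/orP; left.
by apply/negP => /and3P[sE _ /forallP/(_ ord0)]; rewrite degree_single.
Qed.

Lemma two_graph_sum_empty (a : A) : two_graph_sum a 'I_0 = 0.
Proof.
apply: big_pred0 => E; apply/negbTE.
by rewrite /two_graph /connected_graph card_ord /= andbF.
Qed.

(** Deleting the leaf [r] moves the root to its neighbour, whose degree is not recorded; hence the
    weight [1]. The correction at [n = 0] removes the one-vertex graph, because a single edge has
    two leaves. *)
Lemma sum_root_leaf (V : finType) (n : nat) (r : V) : #|V| = n.+2 ->
  \sum_(E : {set {set V}} | conn_planar R E)
    ((degree E r == 1%N) && only_leaf E r)%:R =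
  only_leaf_sum R 1 'I_n.+1 - (n == 0%N)%:R :> A.
Proof.
move=> Vn; pose W : finType := {x : V | x != r}.
have pbij := pick_vertex_bij r.
have cW : #|W| = n.+1 by rewrite card_pick_vertex Vn.
rewrite (sum_relabel pbij).
under eq_bigl do rewrite conn_planar_relabel //.
under eq_bigr => E _.
  rewrite (degree_relabel pbij E None : degree _ r = _).
  rewrite (only_leaf_relabel pbij E None : only_leaf _ r = _) -mulnb natrM.
over.
rewrite (bigID (fun E => degree E None == 1%N)) /= [X in _ + X]big1 ?addr0; last first.
  by move=> E /andP[_ /negPf ->]; rewrite mul0r.
rewrite sum_leaf.
have fbij : bijective (enum_val \o cast_ord (esym cW) : 'I_n.+1 -> W).
  apply: bij_comp; first exact: enum_val_bij.
  by exists (cast_ord cW) => i; apply: val_inj.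
rewrite -(only_leaf_sum_relabel R 1 fbij).
have addE (E : {set {set W}}) u : conn_planar R E ->
    (degree (add_leaf E u) None == 1%N)%:R * (only_leaf (add_leaf E u) None)%:R =
    ((0 < n)%N && only_leaf E u)%:R :> A.
  move=> /and3P[sE cE _].
  by rewrite degree_add_leaf_None eqxx mul1r only_leaf_add_leaf // cW.
under eq_bigr => E KE do under eq_bigr => u _ do rewrite (addE E u KE).
case: n Vn cW fbij addE => [|n] Vn cW fbij _ /=.
  rewrite (only_leaf_sum_relabel R 1 fbij) only_leaf_sum1 subrr.
  by apply: big1 => E _; apply: big1.
rewrite subr0; apply: eq_bigr => E _; rewrite [RHS]big_mkcond /=.
by apply: eq_bigr => u _; rewrite expr1n; case: ifP.
Qed.

(** A root that is not a leaf leaves no leaf at all, which gives the 2-graphs. A root that is a leaf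
    has weight [a], and each of the [n.+2] labels contributes equally. *)
Lemma only_leaf_sum_rec (a : A) (n : nat) :
  only_leaf_sum R a 'I_n.+2 = two_graph_sum a 'I_n.+2 +
    n.+2%:R * a * (only_leaf_sum R 1 'I_n.+1 - (n == 0%N)%:R).
Proof.
rewrite /only_leaf_sum.
under eq_bigr => E _ do rewrite (bigID (fun r => degree E r != 1%N)) /=.
rewrite big_split /=; congr (_ + _).
  rewrite [LHS]big_mkcond [RHS]big_mkcond; apply: eq_bigr => E _.
  rewrite /conn_planar /two_graph.
  case: (boolP (simple_graph E)) => //= sE; case: (boolP (connected_graph E)) => //= cE.
  rewrite andbC; case: asboolP => //= _.
  (* With at least two vertices, connectedness makes all degrees positive, so having no leaf means
     minimum degree at least two. *)
  have d_gt0 s : (0 < degree E s)%N.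
    have /card_gt1P[x [y [_ _ xy]]] : (1 < #|'I_n.+2|)%N by rewrite card_ord.
    have [sx|sx] := eqVneq s x; first by rewrite sx (degree_gt0 cE xy).
    exact: degree_gt0 cE sx.
  case: forallP => [H|H].
    apply: eq_bigl => r; rewrite gtn_eqF // andbT; apply/forallP => s.
    by rewrite gtn_eqF.
  apply: big_pred0 => r; apply/andP => -[/forallP Hr r1]; apply: H => s.
  have := d_gt0 s; rewrite leq_eqVlt eq_sym => /orP[s1|//].
  by have := Hr s; rewrite s1 => /eqP sr; rewrite -sr s1 in r1.
transitivity (\sum_(r : 'I_n.+2) \sum_(E | conn_planar R E)
    a * ((degree E r == 1%N) && only_leaf E r)%:R).
  rewrite exchange_big /=; apply: eq_bigr => E _; rewrite big_mkcond /=.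
  apply: eq_bigr => r _; rewrite negbK andbC.
  by case: ifP => [/andP[/eqP -> _]|_]; rewrite ?mulr1 ?mulr0.
rewrite (eq_bigr (fun=> a * (only_leaf_sum R 1 'I_n.+1 - (n == 0%N)%:R))).
  by rewrite sumr_const card_ord -[LHS]mulr_natl mulrA.
by move=> r _; rewrite -(sum_root_leaf r) ?card_ord // mulr_sumr.
Qed.

End Recurrence.

(** * Generating functions *)

Section FpsCoef.
Variable A : comNzRingType.
Implicit Types f g : fps A.

Lemma fpsXM_coef f n : (fpsX * f) n = if n is m.+1 then f m else 0.
Proof.
case: n => [|n]; rewrite [LHS]/= big_ord_recl mul0r add0r ?big_ord0 //.
rewrite big_ord_recl mul1r /= subSS subn0 big1 ?addr0 // => i _.
by rewrite mul0r.
Qed.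

Lemma fpsXnM_coef f k n : (fpsX ^+ k * f) n = if (k <= n)%N then f (n - k)%N else 0.
Proof.
elim: k n => [|k IH] n; first by rewrite expr0 mul1r subn0.
by rewrite exprS -mulrA fpsXM_coef; case: n => [|n] //; rewrite IH.
Qed.

Lemma fpsCM_coef (a : A) f n : (fpsC a * f) n = a * f n.
Proof.
by rewrite [LHS]/= big_ord_recl /= subn0 big1 ?addr0 // => i _; rewrite mul0r.
Qed.

Lemma fpsC_exp (a : A) k : fpsC a ^+ k = fpsC (a ^+ k).
Proof.
elim: k => [|k IH]; first by apply: fpsP => -[].
by rewrite !exprS IH; apply: fpsP => n; rewrite fpsCM_coef; case: n => //= n; rewrite mulr0.
Qed.

Lemma fps_mul_coef f g n : (f * g) n = \sum_(i < n.+1) f i * g (n - i)%N.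
Proof. by []. Qed.

Lemma fps_sub_coef f g n : (f - g) n = f n - g n. Proof. by []. Qed.

Lemma fps_add_coef f g n : (f + g) n = f n + g n. Proof. by []. Qed.

End FpsCoef.

(** * Exponentials e^(ax) and composition with x e^(-x) *)

Definition fps_expX (a : {poly rat}) : fps_xw := fps_exp (fpsX * fpsC a).

Lemma fps_expX_coef a n : fps_expX a n = (n`!%:R^-1)%:P * a ^+ n.
Proof.
rewrite /fps_expX /fps_exp [LHS]/= big_ord_recr /= big1 ?add0r => [|k _].
  by rewrite exprMn fpsXnM_coef leqnn subnn fpsC_exp.
rewrite exprMn fpsXnM_coef fpsC_exp ltnW //= -(subnSK (ltn_ord k)).
by rewrite mulr0.
Qed.

Lemma fps_expXD a b : fps_expX (a + b) = fps_expX a * fps_expX b.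
Proof.
apply: fpsP => n; rewrite fps_expX_coef addrC exprDn mulr_sumr fps_mul_coef.
apply: eq_bigr => i _; have le_in : (i <= n)%N by rewrite -ltnS.
rewrite !fps_expX_coef mulrACA -polyCM [b ^+ _ * _]mulrC -[X in _ * X = _]mulr_natl [LHS]mulrA.
congr (_ * _); rewrite -polyC_natr -polyCM; congr (_%:P).
rewrite -(bin_fact le_in) !natrM.
have h m : m`!%:R != 0 :> rat by rewrite pnatr_eq0 -lt0n fact_gt0.
have hb : 'C(n, i)%:R != 0 :> rat by rewrite pnatr_eq0 -lt0n bin_gt0.
by field; rewrite !h hb.
Qed.

Lemma fps_expX0 : fps_expX 0 = 1.
Proof.
apply: fpsP => -[|n]; rewrite fps_expX_coef; first by rewrite fact0 invr1 mulr1.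
by rewrite expr0n mulr0.
Qed.

Lemma fps_expX_exp a k : fps_expX a ^+ k = fps_expX (a *+ k).
Proof.
by elim: k => [|k IH]; rewrite ?fps_expX0 // exprS IH mulrS fps_expXD.
Qed.

(* The order of vanishing of g ^+ k lets the product with f be moved inside
   the sum that defines the composition. *)
Lemma mul_fps_comp_coef (f c g : fps_xw) n : g 0%N = 0 ->
  (f * fps_comp c g) n = \sum_(k < n.+1) c k * (f * g ^+ k) n.
Proof.
move=> g0; have gE : g = fpsX * Fps (fun n => g n.+1).
  by apply: fpsP => -[|m]; rewrite fpsXM_coef.
transitivity (\sum_(i < n.+1) f i * \sum_(k < n.+1) c k * (g ^+ k) (n - i)%N).
  rewrite fps_mul_coef; apply: eq_bigr => i _; congr (_ * _); rewrite [LHS]/=.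
  rewrite (big_ord_widen n.+1 (fun k => c k * (g ^+ k) (n - i)%N)) ?ltnS ?leq_subr //.
  rewrite big_mkcond /=; apply: eq_bigr => k _; case: ltnP => // ik.
  by rewrite gE exprMn fpsXnM_coef leqNgt ik mulr0.
under eq_bigr do rewrite mulr_sumr.
rewrite exchange_big /=; apply: eq_bigr => k _; rewrite mulr_sumr.
by apply: eq_bigr => i _; rewrite mulrCA.
Qed.

(** Since (x e^(-x))^k = x^k e^(-kx), the product is the sum of the c_k x^k e^((b-k)x). *)
Lemma mul_comp_expX_coef (b : {poly rat}) (c : fps_xw) n :
  (fps_expX b * fps_comp c (fpsX * fps_expX (- 1))) n =
  \sum_(k < n.+1) c k * (((n - k)`!%:R^-1)%:P * (b - k%:R) ^+ (n - k)).
Proof.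
rewrite mul_fps_comp_coef ?fpsXM_coef //; apply: eq_bigr => k _.
rewrite exprMn fps_expX_exp mulrCA -fps_expXD fpsXnM_coef -ltnS ltn_ord.
by rewrite fps_expX_coef mulNrn.
Qed.

(** * Coefficients of rooted generating functions as weighted sums over graphs *)

Definition rooted_sum (a : {poly rat}) n (P : pred {set {set 'I_n}}) : {poly rat} :=
  \sum_(E | P E) \sum_r a ^+ degree E r.

Lemma degree_lt (n : nat) (E : {set {set 'I_n}}) r : simple_graph E -> (degree E r < n)%N.
Proof.
move=> sE; rewrite -[X in (_ < X)%N](card_ord n) -cardsT; apply: proper_card.
rewrite properT; apply: contraTneq isT => /setP/(_ r).
by rewrite !inE adj_irrefl.
Qed.

(** The cut-off at degrees below [n] in [rooted_gf] loses nothing, by [degree_lt]. *)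
Lemma rooted_gfE (P : forall n, {set {set 'I_n}} -> bool) n :
  (forall E, P n E -> simple_graph E) ->
  rooted_gf P n = (n`!%:R^-1)%:P * rooted_sum 'X (P n).
Proof.
move=> Ps; apply/polyP => k; rewrite coef_poly coefCM /rooted_sum coef_sum.
have -> : \sum_(E | P n E) (\sum_r 'X^(degree E r))`_k = (rooted_count P n k)%:R :> rat.
  rewrite /rooted_count cardsE -sum1_card natr_sum big_mkcond [RHS]big_mkcond /=.
  rewrite -(pair_bigA _ (fun E r => if P n E && (degree E r == k) then 1%:R else 0 : rat)).
  apply: eq_bigr => E _; case: (P n E) => /=; last by rewrite big1.
  rewrite coef_sum; apply: eq_bigr => r _; rewrite coefXn eq_sym.
  by case: (_ == _).
have [kn|kn] := ltnP k n; first by rewrite mulrC.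
rewrite (_ : rooted_count P n k = 0%N) ?mulr0 //.
apply/eqP; rewrite cards_eq0; apply/eqP/setP => -[E r]; rewrite !inE /=.
apply/negbTE; apply/negP => /andP[/Ps sE /eqP rk].
by have := degree_lt r sE; rewrite rk ltnNge kn.
Qed.

Lemma rooted_gf_w1E (P : forall n, {set {set 'I_n}} -> bool) n :
  (forall E, P n E -> simple_graph E) ->
  fps_w1 (rooted_gf P) n = (n`!%:R^-1)%:P * rooted_sum 1 (P n).
Proof.
move=> Ps; rewrite [LHS]/= -[\poly_(k < n) _]/(rooted_gf P n) rooted_gfE //.
rewrite hornerM hornerC polyCM; congr (_ * _).
rewrite /rooted_sum horner_sum rmorph_sum /=; apply: eq_bigr => E _.
rewrite horner_sum rmorph_sum /=; apply: eq_bigr => r _.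
by rewrite hornerXn !expr1n.
Qed.

Section Final.
Variable R : realType.

Definition only_leaf_gf (a : {poly rat}) : fps_xw :=
  Fps (fun n => (n`!%:R^-1)%:P * only_leaf_sum R a 'I_n).

Lemma only_leaf_gf_coef (a : {poly rat}) n :
  only_leaf_gf a n = (n`!%:R^-1)%:P * only_leaf_sum R a 'I_n.
Proof. by []. Qed.

Lemma marked_sum0 (a : {poly rat}) n :
  marked_sum R a (set0 : {set 'I_n}) = rooted_sum a (@connected_planar R n).
Proof.
apply: eq_bigr => E _; apply: eq_bigl => r; rewrite inE /=.
by apply/forall_inP => s; rewrite inE.
Qed.

(** The sieve in terms of series. It serves twice: with [a = 'X] for the bivariate series, and with
    [a = 1], where the exponential factor is [1], for the series at w = 1. *)
Lemma only_leaf_gfE (a : {poly rat}) (c : fps_xw) :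
  (forall n, c n = (n`!%:R^-1)%:P * rooted_sum a (@connected_planar R n)) ->
  fps_expX (1 - a) * fps_comp c (fpsX * fps_expX (- 1)) = only_leaf_gf a.
Proof.
move=> cE; apply: fpsP => n; rewrite mul_comp_expX_coef.
have c0 : c 0%N = 0.
  rewrite cE /rooted_sum big_pred0 ?mulr0 // => E.
  by rewrite /connected_planar /connected_graph card_ord /= andbF.
case: n => [|n]; first by rewrite big_ord_recl big_ord0 c0 mul0r /= only_leaf_sum0 mulr0 addr0.
rewrite big_ord_recl c0 mul0r add0r [RHS]/= only_leaf_sumE mulr_sumr.
apply: eq_bigr => k _; rewrite lift0 subSS cE marked_sum0.
(* The index is shifted because the term without vertices vanishes; this base is the one in
   [only_leaf_sumE], and the factorials combine into the binomial coefficient. *)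
have -> : 1 - a - k.+1%:R = - (k%:R + a) by rewrite -natr1; ring.
rewrite mulrACA -polyCM [rooted_sum _ _ * _]mulrC.
rewrite -['C(_, _)%:R * _ * _]mulrA [RHS]mulrA -(polyC_natr _ 'C(n.+1, k.+1)) -polyCM.
congr (_%:P * _).
have kn : (k.+1 <= n.+1)%N by rewrite ltnS -ltnS.
have -> : n.+1`!%:R = 'C(n.+1, k.+1)%:R * (k.+1`!%:R * (n - k)`!%:R) :> rat.
  by rewrite -(bin_fact kn) subSS -!natrM.
have h m : m`!%:R != 0 :> rat by rewrite pnatr_eq0 -lt0n fact_gt0.
move: (h k.+1) (h (n - k)%N); have : 'C(n.+1, k.+1)%:R != 0 :> rat.
  by rewrite pnatr_eq0 -lt0n bin_gt0.
move: ('C(n.+1, k.+1)%:R) (k.+1`!%:R) ((n - k)`!%:R) => x y z x0 y0 z0.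
by field; rewrite x0 y0 z0.
Qed.

End Final.

Theorem theorem17 (R : realType) :
  Hgf R =
    fps_exp (fpsX * (1 - fpsW)) * fps_comp (Cgf R) (fpsX * fps_exp (- fpsX))
    - fpsX * fpsW * fps_comp (fps_w1 (Cgf R)) (fpsX * fps_exp (- fpsX))
    - fpsX + fpsX ^+ 2 * fpsW.
Proof.
have CW : 1 - fpsW = fpsC (1 - 'X).
  by apply: fpsP => -[|n]; rewrite fps_sub_coef //= subr0.
have XN : - fpsX = fpsX * fpsC (- 1) :> fps_xw.
  by apply: fpsP => -[|[|n]]; rewrite fpsXM_coef //= oppr0.
have Psimple n E : connected_planar R E -> @simple_graph 'I_n E by case/and3P.
have C1 : fps_comp (fps_w1 (Cgf R)) (fpsX * fps_exp (- fpsX)) = only_leaf_gf R 1.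
  rewrite XN -/(fps_expX _) -(only_leaf_gfE (c := fps_w1 (Cgf R))).
    by rewrite subrr fps_expX0 mul1r.
  by move=> n; apply: rooted_gf_w1E => E; exact: Psimple.
have C2 : fps_exp (fpsX * (1 - fpsW)) * fps_comp (Cgf R) (fpsX * fps_exp (- fpsX)) =
    only_leaf_gf R 'X.
  rewrite XN CW -!/(fps_expX _); apply: only_leaf_gfE => n.
  by apply: rooted_gfE => E; exact: Psimple.
rewrite C1 C2; apply: fpsP => n.
rewrite fps_add_coef !fps_sub_coef -mulrA fpsXM_coef fpsXnM_coef.
have -> : Hgf R n = (n`!%:R^-1)%:P * two_graph_sum R 'X 'I_n.
  by apply: rooted_gfE => E /andP[/and3P[]].
(* At [n = 1] the one-vertex graph is cancelled by the term [- fpsX]; from [n = 2] on, the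
   recurrence applies. *)
case: n => [|[|n]].
- by rewrite two_graph_sum_empty only_leaf_gf_coef only_leaf_sum0 mulr0 !subr0 addr0.
- rewrite two_graph_sum_single fpsCM_coef !only_leaf_gf_coef only_leaf_sum1 only_leaf_sum0.
  by rewrite !mulr0 invr1 mulr1 subr0 subrr addr0.
rewrite fpsCM_coef !only_leaf_gf_coef only_leaf_sum_rec subn2 /=.
have cd : (n.+2`!%:R^-1)%:P * n.+2%:R = (n.+1`!%:R^-1)%:P :> {poly rat}.
  by rewrite -polyC_natr -polyCM factS natrM invfM mulrAC mulVf ?mul1r //.
(* The term x^2 w is exactly the correction for the single edge in the recurrence. *)
have -> : (if n is 0 then 'X else 0) = (n.+1`!%:R^-1)%:P * 'X * (n == 0%N)%:R :> {poly rat}.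
  by case: n {cd} => [|n] /=; rewrite ?mulr0 // mulr1 invr1 mul1r.
rewrite -cd; ring.
Qed.
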